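(* There is an absolute constant $M$ such that, with $c=\sqrt2-1$, the following holds. Let $0<a<b$ and let $F:\mathbb{R}^d\to\mathbb{R}^d$ be a continuously differentiable vector field with $F(\omega^* )=0$ such that every eigenvalue of $\mathbf{J}_F(\omega^* )$ lies in $[ia,ib]\cup[-ia,-ib]$. Then there exist $\alpha,\beta,\eta>0$ such that the iteration $$\omega_{t+1}=\omega_t-\alpha F(\omega_t-\eta F(\omega_t))+\beta(\omega_t-\omega_{t-1})$$ converges locally to $\omega^*$ at the linear rate $O\Big(\big(1-c\frac{a}{b}+M\frac{a^2}{b^2}\big)^t\Big)$.
   Context: For $z,w\in\mathbb{C}$, $[z,w]$ denotes the closed segment joining $z$ and $w$. For $0<\rho<1$, a two-step iteration $\omega_{t+1}=V(\omega_t,\omega_{t-1})$ with $V(\omega^*,\omega^* )=\omega^*$ ''converges locally to $\omega^*$ at the linear rate $O(\rho^t)$'' if there exist a neighbourhood $U$ of $\omega^*$ and a constant $C$ such that for all $\omega_0,\omega_1\in U$ and all $t\ge0$, $\|\omega_t-\omega^*\|\le C\rho^t$. The rate assertion is only meaningful, and is only asserted, when the displayed $\rho$ is less than $1$. *)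

(* Defs.v *)
(* MathComp-Analysis, with R[i] from real-closed. *)
From HB Require Import structures.
From mathcomp Require Import all_boot all_order all_algebra.
From mathcomp Require Import complex.
From mathcomp Require Import all_classical all_reals all_analysis.

Set Implicit Arguments.
Unset Strict Implicit.
Unset Printing Implicit Defensive.

Import Order.TTheory GRing.Theory Num.Theory.
Import numFieldNormedType.Exports.

Local Open Scope classical_set_scope.
Local Open Scope ring_scope.
Local Open Scope complex_scope.

Definition csegment (R : realType) (z w : R[i]) : set R[i] :=
  [set (1 - t)%:C * z + t%:C * w | t in `[0, 1]%classic].

Definition C1_field (R : realType) (d : nat) (F : 'rV[R]_d -> 'rV[R]_d) :=
  (forall x, differentiable F x) /\ continuous (jacobian F).

(* Vectors are rows: [jacobian F x] is the transpose of the usual Jacobian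
   matrix, and [eigenvalue] is about row eigenvectors [v *m A = z *: v], so
   the two conventions match. *)
Definition jacobian_eigenvalue (R : realType) (d : nat)
    (F : 'rV[R]_d -> 'rV[R]_d) (x : 'rV[R]_d) (z : R[i]) : bool :=
  eigenvalue (map_mx (real_complex R) (jacobian F x)) z.

(* [V x y] is the successor of the current iterate [x] with previous iterate
   [y]. *)
Definition two_step_iterates (T : Type) (V : T -> T -> T) (w : nat -> T) :=
  forall t, w t.+2 = V (w t.+1) (w t).

Definition converges_locally_linearly (R : realType) (E : normedModType R)
    (V : E -> E -> E) (ws : E) (rho : R) :=
  [/\ 0 < rho < 1,
      V ws ws = ws &
      exists (U : set E) (C : R), nbhs ws U /\
        forall w : nat -> E, two_step_iterates V w -> U (w 0%N) -> U (w 1%N) ->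
          forall t, `|w t - ws| <= C * rho ^+ t].

Definition eg_momentum (R : realType) (d : nat) (F : 'rV[R]_d -> 'rV[R]_d)
    (alpha beta eta : R) (x y : 'rV[R]_d) : 'rV[R]_d :=
  x - alpha *: F (x - eta *: F x) + beta *: (x - y).

(* Main.v *)
Require Import Defs.
From mathcomp Require Import all_boot all_order all_algebra.
From mathcomp Require Import complex.
From mathcomp Require Import all_classical all_reals all_analysis.
From mathcomp Require Import ring lra.

(* With x = a/b, take beta = (1-x)^2, alpha = x^2/(16b) and eta = 16/(x^2 b):
   eta is so large that alpha * eta = 1/b^2 dominates, and on the eigenvalues
   i s the method behaves like heavy-ball gradient descent for the quadratic
   with Hessian -J^2, whose condition number is (b/a)^2.  This yields the rate
   1 - x/2, which is below 1 - (sqrt 2 - 1) x, so M = 0 works.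
   Locally, the companion matrix of the linearized iteration has spectral
   radius < r := 1 - x/2; by Cayley-Hamilton its powers are O(r^t), hence
   sup_t |z A^t| / r^t is a norm contracted by A with factor r, and the
   nonlinear remainder only enlarges r to any prescribed rho > r near the
   fixed point. *)

Set Implicit Arguments.
Unset Strict Implicit.
Unset Printing Implicit Defensive.

Import Order.TTheory GRing.Theory Num.Theory.
Import numFieldNormedType.Exports.

Local Open Scope classical_set_scope.
Local Open Scope ring_scope.
Local Open Scope complex_scope.

(** * Growth of matrix powers under a spectral bound *)

(** The constant [B = K / (r - |mu|)] solves [K + |mu| * B = r * B], so the induction reproduces it;
    adding [|u 0|] covers the start and only leaves slack. *)
Lemma geometric_bound_first_order (C : numFieldType) (u : nat -> C)
    (mu r K : C) :
  `|mu| < r -> (forall t, `|u t.+1 - mu * u t| <= K * r ^+ t) ->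
  forall t, `|u t| <= (`|u 0%N| + K / (r - `|mu|)) * r ^+ t.
Proof.
move=> mur ub; have gap0 : 0 < r - `|mu| by rewrite subr_gt0.
have r0 : 0 < r by apply: le_lt_trans mur.
have K0 : 0 <= K by have := ub 0%N; rewrite expr0 mulr1; apply: le_trans.
elim=> [|t IH].
  by rewrite expr0 mulr1 lerDl divr_ge0 // ltW.
have -> : u t.+1 = (u t.+1 - mu * u t) + mu * u t by rewrite subrK.
apply: le_trans (ler_normD _ _) _; rewrite normrM.
apply: le_trans (lerD (ub t) (ler_wpM2l (normr_ge0 mu) IH)) _.
rewrite exprS !mulrA -mulrDl ler_wpM2r ?exprn_ge0 ?(ltW r0)//.
rewrite -subr_ge0.
have -> : (`|u 0%N| + K / (r - `|mu|)) * r - (K + `|mu| * (`|u 0%N| + K / (r - `|mu|)))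
   = (r - `|mu|) * `|u 0%N|.
  by field; rewrite gt_eqF.
by rewrite mulr_ge0 // ltW.
Qed.

(* Multiplying X by (A - mu) amounts to applying the first-order recurrence
   operator u t.+1 - mu * u t to every entry of t |-> X * A ^+ t. *)
Lemma geometric_bound_annihilated (C : numFieldType) (n : nat)
    (A X : 'M[C]_n.+1) (s : seq C) (r : C) :
  {in s, forall mu, `|mu| < r} -> X * \prod_(mu <- s) (A - mu%:M) = 0 ->
  exists K, forall t i j, `|(X * A ^+ t) i j| <= K * r ^+ t.
Proof.
elim: s X => [|mu s IH] X sr.
  rewrite big_nil mulr1 => ->; exists 0 => t i j.
  by rewrite mul0r mxE normr0 mul0r.
rewrite big_cons mulrA => /IH [nu nus|K KP]; first by rewrite sr ?inE ?nus ?orbT.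
have mur : `|mu| < r by rewrite sr ?inE ?eqxx.
exists (\sum_i \sum_j `|X i j| + K / (r - `|mu|)) => t i j.
have := @geometric_bound_first_order C (fun t => (X * A ^+ t) i j) mu r K mur.
move=> /(_ _ t) /=; rewrite expr0 mulr1 => H.
apply: le_trans (H _) _ => [k|].
  have := KP k i j; congr (`| _ | <= _).
  rewrite mulrBr mulrBl mxE exprS mulrA; congr (_ + _).
  have -> : X * mu%:M = mu *: X by exact: mul_mx_scalar.
  by rewrite -scalerAl [in LHS]mxE [in LHS]mxE.
rewrite ler_wpM2r ?exprn_ge0 ?(le_trans _ (ltW mur))// lerD2r.
rewrite (bigD1 i)//= (bigD1 j)//= -addrA lerDl addr_ge0 ?sumr_ge0// => *.
exact: sumr_ge0.
Qed.

(** The characteristic polynomial splits over a closed field, so by Cayley-Hamilton the product over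
    its roots annihilates [X = 1]. *)
Lemma power_bound (C : numClosedFieldType) (n : nat) (A : 'M[C]_n.+1) (r : C) :
  (forall z, eigenvalue A z -> `|z| < r) ->
  exists K, forall t i j, `|(A ^+ t) i j| <= K * r ^+ t.
Proof.
move=> Ar; have [s] := closed_field_poly_normal (char_poly A).
rewrite (monicP (char_poly_monic A)) scale1r => sE.
have [z zs||K KP] := @geometric_bound_annihilated C n A 1 s r.
- by apply: Ar; rewrite eigenvalue_root_char sE root_prod_XsubC.
- rewrite mul1r -(Cayley_Hamilton A) sE rmorph_prod.
  by apply: eq_bigr => z _; rewrite rmorphB/= horner_mx_X horner_mx_C.
by exists K => t i j; rewrite -[A ^+ t]mul1r.
Qed.

Lemma real_power_bound (R : realType) (n : nat) (A : 'M[R]_n) (r : R) :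
  0 <= r ->
  (forall z, eigenvalue (map_mx (real_complex R) A) z -> `|z| < r%:C) ->
  exists K, forall t i j, `|(A ^+ t) i j| <= K * r ^+ t.
Proof.
move=> r0; case: n A => [A _|n A Ar]; first by exists 0 => t [].
have [K KP] := @power_bound _ n _ r%:C Ar.
(* The order on [R[i]] relates only numbers with equal imaginary parts, so the real part of [K]
   carries the bound. *)
exists (complex.Re K) => t i j; have := KP t i j.
have -> : map_mx (real_complex R) A ^+ t = map_mx (real_complex R) (A ^+ t).
  by rewrite rmorphXn.
rewrite mxE normc_def /= expr0n /= addr0 sqrtr_sqr -rmorphXn/= lecE.
by case: (K) => x y /= /andP[_]; rewrite mulr0 subr0.
Qed.

(** * Estimates for the max norm *)

Lemma mx_norm_entry_le (R : realType) (m n : nat) (x : 'M[R]_(m, n)) i j :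
  `|x i j| <= `|x|.
Proof.
rewrite [leRHS]/Num.Def.normr /= mx_normrE.
exact: (le_bigmax _ (fun ij => `|x ij.1 ij.2|) (i, j)).
Qed.

Lemma mx_norm_leP (R : realType) (m n : nat) (x : 'M[R]_(m, n)) (k : R) :
  0 <= k -> (forall i j, `|x i j| <= k) -> `|x| <= k.
Proof.
move=> k0 xk; rewrite [leLHS]/Num.Def.normr /= mx_normrE.
by apply: bigmax_le => // -[i j] _; exact: xk.
Qed.

Lemma norm_mulmx_entrywise_le (R : realType) (n p : nat) (x : 'rV[R]_n)
    (M : 'M[R]_(n, p)) (k : R) :
  0 <= k -> (forall i j, `|M i j| <= k) -> `|x *m M| <= n%:R * k * `|x|.
Proof.
move=> k0 Mk; apply: mx_norm_leP => [|i j]; first by rewrite !mulr_ge0.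
rewrite mxE; apply: le_trans (ler_norm_sum _ _ _) _.
apply: (@le_trans _ _ (\sum_(l < n) k * `|x|)).
  by apply: ler_sum => l _; rewrite normrM mulrC ler_pM // mx_norm_entry_le.
by rewrite sumr_const card_ord -[leLHS]mulr_natl mulrA.
Qed.

Lemma norm_mulmx_le (R : realType) (n p : nat) (M : 'M[R]_(n, p)) :
  exists2 L : R, 0 < L & forall x : 'rV[R]_n, `|x *m M| <= L * `|x|.
Proof.
exists (n%:R * `|M| + 1) => [|x]; first by rewrite ltr_wpDl // mulr_ge0.
apply: le_trans (_ : n%:R * `|M| * `|x| <= _); last first.
  by rewrite ler_wpM2r // lerDl.
by apply: norm_mulmx_entrywise_le => // i j; exact: mx_norm_entry_le.
Qed.

Lemma norm_row_mx_le (R : realType) (m n : nat) (x : 'rV[R]_m) (y : 'rV[R]_n)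
    (k : R) :
  `|x| <= k -> `|y| <= k -> `|row_mx x y| <= k.
Proof.
move=> xk yk; apply: mx_norm_leP => [|i j].
  exact: le_trans (normr_ge0 _) xk.
rewrite mxE; case: fintype.splitP => l _; first exact: le_trans (mx_norm_entry_le _ _ _) xk.
exact: le_trans (mx_norm_entry_le _ _ _) yk.
Qed.

Lemma norm_lsubmx_le (R : realType) (m n : nat) (z : 'rV[R]_(m + n)) :
  `|lsubmx z| <= `|z|.
Proof. by apply: mx_norm_leP => // i j; rewrite mxE mx_norm_entry_le. Qed.

Lemma norm_rsubmx_le (R : realType) (m n : nat) (z : 'rV[R]_(m + n)) :
  `|rsubmx z| <= `|z|.
Proof. by apply: mx_norm_leP => // i j; rewrite mxE mx_norm_entry_le. Qed.

(** * Adapted norm and stability under small perturbations *)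

(** In the supremum over [t], the term [t = 0] gives the lower bound and the power bound gives the
    upper one; applying [A] shifts [t] by one, at the cost of a factor [r]. *)
Lemma adapted_norm (R : realType) (n : nat) (A : 'M[R]_n) (r : R) :
  0 < r ->
  (forall z, eigenvalue (map_mx (real_complex R) A) z -> `|z| < r%:C) ->
  exists (N : 'rV[R]_n -> R) (C : R), [/\ 0 < C,
    forall x, `|x| <= N x <= C * `|x|,
    forall x y, N (x + y) <= N x + N y &
    forall x, N (x *m A) <= r * N x].
Proof.
move=> r0 /(real_power_bound (ltW r0))[K0 K0P].
(* For [n = 0] the entry bound says nothing about the sign of [K0]. *)
pose K := Num.max K0 0.
have K_ge0 : 0 <= K by rewrite le_max lexx orbT.
have KP t i j : `|(A ^+ t) i j| <= K * r ^+ t.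
  apply: le_trans (K0P t i j) _; rewrite ler_wpM2r ?exprn_ge0 ?(ltW r0)//.
  by rewrite le_max lexx.
pose C := n%:R * K + 1.
have C0 : 0 < C by rewrite ltr_wpDl // mulr_ge0.
pose S (x : 'rV[R]_n) := [set `|x *m A ^+ t| / r ^+ t | t in [set: nat]].
have SC x : ubound (S x) (C * `|x|).
  move=> _ [t _ <-]; rewrite ler_pdivrMr ?exprn_gt0//.
  apply: le_trans (norm_mulmx_entrywise_le _ _ _) _;
    [|exact: KP|] => /=.
    by rewrite mulr_ge0 // exprn_ge0 // ltW.
  rewrite mulrA mulrAC ler_wpM2r ?exprn_ge0 ?(ltW r0)// ler_wpM2r //.
  by rewrite lerDl.
have Sub x t : `|x *m A ^+ t| / r ^+ t <= sup (S x).
  by apply: ub_le_sup; [exists (C * `|x|); exact: SC | exists t].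
have S0 x : S x !=set0 by exists (`|x *m A ^+ 0| / r ^+ 0); exists 0%N.
exists (fun x => sup (S x)), C; split => // [x|x y|x].
- rewrite (ge_sup (S0 x) (SC x)) andbT.
  by have := Sub x 0%N; rewrite !expr0 divr1 mulmx1.
- apply: ge_sup => // _ [t _ <-]; rewrite mulmxDl.
  apply: le_trans (lerD (Sub x t) (Sub y t)); rewrite -mulrDl.
  by rewrite ler_wpM2r ?ler_normD// invr_ge0 exprn_ge0 // ltW.
- apply: ge_sup => // _ [t _ <-].
  have := Sub x t.+1; rewrite -(ler_pM2l r0); apply: le_trans.
  rewrite [A ^+ t.+1]exprS -[A * _]/(A *m _) mulmxA exprS invfM.
  by rewrite [r * _]mulrCA mulVKf ?gt_eqF.
Qed.

(** A remainder of size [(rho - r) / C * |h|] costs at most [(rho - r) * N h] in the adapted norm,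
    so [G] contracts [N] by [r + (rho - r) = rho] near 0. *)
Lemma perturbed_linear_iteration (R : realType) (n : nat) (A : 'M[R]_n)
    (r rho : R) (G : 'rV[R]_n -> 'rV[R]_n) :
  0 < r -> r < rho -> rho < 1 ->
  (forall z, eigenvalue (map_mx (real_complex R) A) z -> `|z| < r%:C) ->
  (forall e, 0 < e -> exists2 d : R, 0 < d &
    forall h, `|h| <= d -> `|G h - h *m A| <= e * `|h|) ->
  exists d C, 0 < d /\ forall z : nat -> 'rV[R]_n,
    (forall t, z t.+1 = G (z t)) -> `|z 0%N| <= d ->
    forall t, `|z t| <= C * rho ^+ t.
Proof.
move=> r0 rrho rho1 /(adapted_norm r0)[N [C [C0 NC ND NA]]] Gsmall.
have rho0 : 0 < rho := lt_trans r0 rrho.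
have N_ge x : `|x| <= N x by have /andP[] := NC x.
have N_le x : N x <= C * `|x| by have /andP[] := NC x.
have N0 x : 0 <= N x := le_trans (normr_ge0 x) (N_ge x).
have [d d0 dP] := Gsmall ((rho - r) / C) (divr_gt0 (etrans (subr_gt0 _ _) rrho) C0).
have step h : `|h| <= d -> N (G h) <= rho * N h.
  move=> hd; rewrite -(subrK (h *m A) (G h)).
  apply: le_trans (ND _ _) _; rewrite -(subrK r rho) mulrDl.
  rewrite lerD ?NA//; apply: le_trans (N_le _) _.
  rewrite -ler_pdivlMl // mulrA [C^-1 * _]mulrC.
  apply: le_trans (dP _ hd) _; rewrite ler_wpM2l ?N_ge//.
  by rewrite divr_ge0 ?ltW// subr_gt0.
(* Starting within [d / C] gives [N (z 0) <= d]; as [N] dominates the norm, the bound [d * rho ^+ t]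
   keeps every iterate where [step] applies. *)
exists (d / C), d; split=> [|z zG z0 t]; first exact: divr_gt0.
suff H : N (z t) <= d * rho ^+ t by exact: le_trans (N_ge _) H.
elim: t => [|t IH].
  rewrite expr0 mulr1; apply: le_trans (N_le _) _.
  by rewrite mulrC -ler_pdivlMr.
rewrite zG exprS mulrCA; apply: le_trans (step _ _) _; last first.
  by rewrite ler_wpM2l // ltW.
apply: le_trans (N_ge _) (le_trans IH _).
by rewrite ler_piMr ?exprn_ile1 // ltW.
Qed.

(** * First-order expansion of the iteration *)

Lemma jacobian_first_order (R : realType) (m n : nat)
    (F : 'rV[R]_m -> 'rV[R]_n) (p : 'rV[R]_m) (e : R) :
  differentiable F p -> 0 < e ->
  exists2 d : R, 0 < d & forall h, `|h| <= d ->
    `|F (p + h) - F p - h *m jacobian F p| <= e * `|h|.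
Proof.
move=> dF e0.
have /eqaddoP/(_ e e0) := diff_locally dF.
(* [dP] holds on an open ball; halving the radius permits a non-strict bound on [h]. *)
move=> /nbhs_normP[d /= d0 dP]; exists (d / 2) => [|h hd].
  by rewrite divr_gt0.
have := dP h; rewrite /ball_ /= sub0r normrN => H.
rewrite /jacobian mul_rV_lin1 [p + h]addrC -addrA -opprD; apply: H.
by apply: le_lt_trans hd _; rewrite ltr_pdivrMr // mulr_natr mulr2n ltrDl.
Qed.

(** The previous iterate enters linearly, so the error involves only the remainders [E] and [E'] of
    the two evaluations of [F]: it equals [- alpha (E' - eta E J)]. *)
Lemma eg_momentum_first_order (R : realType) (d : nat)
    (F : 'rV[R]_d -> 'rV[R]_d) (ws : 'rV[R]_d) (alpha beta eta : R) (e : R) :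
  let J := jacobian F ws in
  differentiable F ws -> F ws = 0 -> 0 < e ->
  exists2 del : R, 0 < del & forall h k, `|h| <= del ->
    `|eg_momentum F alpha beta eta (ws + h) (ws + k) - ws
      - ((1 + beta) *: h - alpha *: ((h - eta *: (h *m J)) *m J) - beta *: k)|
      <= e * `|h|.
Proof.
move=> J dF F0 e0.
have [L L0 LP] := norm_mulmx_le J.
have [a a0 aP] : exists2 a : R, 0 < a & `|alpha| <= a.
  by exists (`|alpha| + 1); rewrite ?lerDl// ltr_wpDl.
have [c c0 cP] : exists2 c : R, 0 < c & `|eta| <= c.
  by exists (`|eta| + 1); rewrite ?lerDl// ltr_wpDl.
(* [q] bounds [|g| / |h|] for the extrapolated displacement [g], using [e1 <= 1]; [m] bounds the
   combined remainder relative to [e1 * |h|]. *)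
pose q := 1 + c * L + c.
have q0 : 0 < q by have := mulr_gt0 c0 L0; rewrite /q; lra.
pose m := q + c * L.
have m0 : 0 < m by have := mulr_gt0 c0 L0; rewrite /m; lra.
pose e1 := Num.min 1 (e / (a * m)).
have e10 : 0 < e1 by rewrite lt_min ltr01 divr_gt0 // mulr_gt0.
have e11 : e1 <= 1 by rewrite ge_min lexx.
have e1e : e1 <= e / (a * m) by rewrite ge_min lexx orbT.
have [d1 d10 d1P] := jacobian_first_order dF e10.
(* The radius [d1 / q] keeps [g] within [d1] as well. *)
exists (Num.min d1 (d1 / q)) => [|h k]; first by rewrite lt_min d10 divr_gt0.
rewrite le_min => /andP[hd1]; rewrite ler_pdivlMr // mulrC => hdq.
have := d1P h hd1; rewrite F0 subr0 -/J; set E := F (ws + h) - _ => EP.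
have FE : F (ws + h) = h *m J + E by rewrite [RHS]addrC subrK.
clearbody E.
pose g := h - eta *: (h *m J + E).
have gq : `|g| <= q * `|h|.
  apply: le_trans (ler_normB _ _) _; rewrite normrZ /q !mulrDl mul1r -addrA.
  rewrite lerD2l -[c * L * _]mulrA -mulrDr ler_pM //.
  apply: le_trans (ler_normD _ _) _; rewrite lerD //.
  by apply: le_trans EP _; rewrite ler_piMl.
have := d1P g (le_trans gq hdq); rewrite F0 subr0 -/J.
set E' := F (ws + g) - _ => E'P.
have FE' : F (ws + g) = g *m J + E' by rewrite [RHS]addrC subrK.
clearbody E'.
rewrite /eg_momentum FE -[ws + h - eta *: _]addrA -/g FE'.
have -> : ws + h - alpha *: (g *m J + E') + beta *: (ws + h - (ws + k)) - ws
   - ((1 + beta) *: h - alpha *: ((h - eta *: (h *m J)) *m J) - beta *: k)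
   = - (alpha *: (E' - eta *: (E *m J))).
  rewrite /g !mulmxBl -!scalemxAl !mulmxDl.
  move: (h *m J *m J) (h *m J) (E *m J) => hJJ hJ EJ.
  by apply/matrixP => i j; rewrite !mxE; ring.
rewrite normrN normrZ.
apply: (@le_trans _ _ (a * (e1 * m * `|h|))); last first.
  rewrite !mulrA ler_wpM2r // mulrAC mulrC -ler_pdivlMr ?mulr_gt0//.
rewrite ler_pM //; apply: le_trans (ler_normB _ _) _.
rewrite normrZ /m mulrDr mulrDl lerD //.
  by apply: le_trans E'P _; rewrite -mulrA ler_wpM2l // ltW.
have -> : e1 * (c * L) * `|h| = c * (L * (e1 * `|h|)) by ring.
by rewrite ler_pM //; apply: le_trans (LP _) _; rewrite ler_wpM2l // ltW.
Qed.

(** * Spectrum of the linearized iteration *)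

(** Factor the quadratic as [c2 (X - l1) (X - l2)]: either [w] is an eigenvector for [l1], or
    [w (J - l1)] is a nonzero eigenvector for [l2]. *)
Lemma eigenvalue_quadratic_root (C : closedFieldType) (d : nat) (J : 'M[C]_d)
    (w : 'rV[C]_d) (c0 c1 c2 : C) :
  w != 0 -> c2 != 0 ->
  c0 *: w + c1 *: (w *m J) + c2 *: (w *m J *m J) = 0 ->
  exists2 l, eigenvalue J l & c0 + c1 * l + c2 * l ^+ 2 = 0.
Proof.
move=> w0 c20 wJ.
have /closed_rootP[l1] : size (Poly [:: c0; c1; c2]) != 1%N.
  by rewrite (PolyK (c := 0)).
rewrite /root (_ : _.[l1] = c0 + c1 * l1 + c2 * l1 ^+ 2); last first.
  by rewrite horner_Poly /=; ring.
move=> /eqP l1P.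
have c0E : c0 = - (c1 * l1 + c2 * l1 ^+ 2) by apply/eqP; rewrite -addr_eq0 addrA l1P.
have [v0|v0] := eqVneq (w *m J - l1 *: w) 0.
  by exists l1 => //; apply/eigenvalueP; exists w => //; exact/subr0_eq.
(* The second root, by Vieta. *)
exists (- (c1 + c2 * l1) / c2); last by rewrite c0E; field.
apply/eigenvalueP; exists (w *m J - l1 *: w) => //.
apply: (scalerI c20); apply/eqP; rewrite scalerA mulrC divfK // -subr_eq0.
rewrite -[X in _ == X]wJ c0E mulmxBl -scalemxAl; apply/eqP/matrixP => i j.
by rewrite !mxE; ring.
Qed.

(** A row eigenvector [(y, w)] has [y = z w], which leaves a quadratic in [J] killing [w]. Since
    [be != 0] forces [z != 0], its leading coefficient [- (z * p2)] is nonzero. *)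
Lemma companion_eigenvalue (C : closedFieldType) (d : nat) (J : 'M[C]_d)
    (p0 p1 p2 be z : C) :
  be != 0 -> p2 != 0 ->
  eigenvalue (block_mx (p0%:M + p1 *: J + p2 *: (J *m J)) 1%:M (- be%:M) 0) z ->
  exists2 l, eigenvalue J l &
    z ^+ 2 - (p0 + p1 * l + p2 * l ^+ 2) * z + be = 0.
Proof.
move=> be0 p20 /eigenvalueP[v]; rewrite -[v]hsubmxK.
move: (lsubmx v) (rsubmx v) => y w.
rewrite mul_row_block scale_row_mx mulmx1 mulmx0 addr0 => /eq_row_mx[].
move=> + yE yw0; rewrite {}yE in yw0 *.
rewrite mulmxN mul_mx_scalar => Ew.
have w0 : w != 0.
  by apply: contraNneq yw0 => ->; rewrite scaler0 row_mx0.
have z0 : z != 0.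
  apply: contraNneq w0 => z0; move: Ew.
  rewrite z0 !scale0r mul0mx sub0r => /eqP.
  by rewrite oppr_eq0 scaler_eq0 (negPf be0).
have [||l Jl lP] := @eigenvalue_quadratic_root C d J w
    (z ^+ 2 - z * p0 + be) (- (z * p1)) (- (z * p2)) w0.
- by rewrite oppr_eq0 mulf_neq0.
- move: Ew; rewrite !mulmxDr mul_mx_scalar -!scalemxAr mulmxA -!scalemxAl => Ew.
  apply/eqP; rewrite -oppr_eq0; apply/eqP; rewrite -[RHS](subrr (z *: (z *: w))).
  rewrite -{1}Ew; apply/matrixP => i j; rewrite !mxE; ring.
by exists l => //; rewrite -[RHS]lP; ring.
Qed.

(* Here z = u + i v satisfies z^2 - (P - i Q) z + be = 0.  On the circle
   |z|^2 = n, the point z + be / z runs through an ellipse with semi-axes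
   (n + be) / sqrt n and (n - be) / sqrt n, which contains P - i Q in its
   interior as soon as n >= r^2; E3 below is the equation of that ellipse. *)
Lemma momentum_root_modulus (R : realFieldType) (x s u v : R) :
  let r := 1 - x / 2 in let be := (1 - x) ^+ 2 in
  let P := 1 + be - s ^+ 2 in let Q := x ^+ 2 * s / 16 in
  0 < x < 1 -> x ^+ 2 <= s ^+ 2 <= 1 ->
  u ^+ 2 - v ^+ 2 - (P * u + Q * v) + be = 0 ->
  2 * u * v - (P * v - Q * u) = 0 ->
  u ^+ 2 + v ^+ 2 < r ^+ 2.
Proof.
move=> r be P Q /andP[x0 x1] /andP[xs s1] Eu Ev.
rewrite ltNge; apply/negP => rn.
set n := u ^+ 2 + v ^+ 2 in rn.
(* [E1] and [E2] are the real and imaginary parts of the equation multiplied by the conjugate of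
   [z]. *)
have E1 : n * P = u * (n + be).
  have : u * (u ^+ 2 - v ^+ 2 - (P * u + Q * v) + be) +
         v * (2 * u * v - (P * v - Q * u)) = 0 by rewrite Eu Ev !mulr0 addr0.
  by rewrite /n; lra.
have E2 : n * Q = - v * (n - be).
  have : v * (u ^+ 2 - v ^+ 2 - (P * u + Q * v) + be) -
         u * (2 * u * v - (P * v - Q * u)) = 0 by rewrite Eu Ev !mulr0 subr0.
  by rewrite /n; lra.
have be0 : 0 < be by rewrite exprn_gt0 // subr_gt0.
have r0 : 0 < r by rewrite /r; lra.
have x20 : 0 < x ^+ 2 by rewrite exprn_gt0.
have rbe : x / 4 <= r ^+ 2 - be by rewrite /r /be; nra.
have n0 : 0 < n by apply: lt_le_trans rn; rewrite exprn_gt0.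
have nbe : 0 < n - be by lra.
have E3 : n * P ^+ 2 * (n - be) ^+ 2 + n * Q ^+ 2 * (n + be) ^+ 2
          = (n + be) ^+ 2 * (n - be) ^+ 2.
  apply: (mulfI (lt0r_neq0 n0)).
  have -> : n * (n * P ^+ 2 * (n - be) ^+ 2 + n * Q ^+ 2 * (n + be) ^+ 2) =
    (n * P) ^+ 2 * (n - be) ^+ 2 + (n * Q) ^+ 2 * (n + be) ^+ 2 by ring.
  by rewrite E1 E2 {5}/n; ring.
have P0 : 0 <= P by rewrite /P; lra.
(* Equality holds at [s ^+ 2 = x ^+ 2], the extreme case for [P]. *)
have rP : r * P <= r ^+ 2 + be - x ^+ 2 / 4.
  rewrite -subr_ge0 (_ : _ - _ = r * (s ^+ 2 - x ^+ 2)).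
    by rewrite mulr_ge0 ?(ltW r0)// subr_ge0.
  by rewrite /P /r /be; field.
pose S := r ^+ 2 + be.
have S0 : 0 < S by rewrite addr_gt0 // exprn_gt0.
have S2 : S <= 2 by rewrite /S /r /be; nra.
have Sx : x ^+ 2 / 4 <= S by rewrite /S /r /be; nra.
have rPS : (r * P) ^+ 2 <= S ^+ 2 * (1 - x ^+ 2 / 8).
  apply: le_trans (_ : (S - x ^+ 2 / 4) ^+ 2 <= _).
    by apply: lerXn2r; rewrite ?nnegrE ?subr_ge0 ?mulr_ge0 ?(ltW r0).
  have : 0 <= x ^+ 2 * (S * (2 - S)) by rewrite !mulr_ge0 ?subr_ge0 // ltW.
  have : 0 <= x ^+ 2 * (S - x ^+ 2 / 4) by rewrite mulr_ge0 ?subr_ge0 // ltW.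
  have : 0 <= x ^+ 2 * S by rewrite mulr_ge0 ?ltW.
  by nra.
(* For [n > be] both [n / (n + be)^2] and [n / (n - be)^2] decrease in [n], so [n = r^2] is the
   worst case here and in [nQ]. *)
have nP : n * P ^+ 2 <= (1 - x ^+ 2 / 8) * (n + be) ^+ 2.
  rewrite -(ler_pM2l (exprn_gt0 2 S0)).
  apply: le_trans (_ : (r * P) ^+ 2 * (n + be) ^+ 2 <= _); last first.
    by rewrite [leRHS]mulrA ler_wpM2r // sqr_ge0.
  rewrite -subr_ge0 (_ : _ - _ = P ^+ 2 * ((n - r ^+ 2) * (r ^+ 2 * n - be ^+ 2))).
    rewrite mulr_ge0 ?sqr_ge0 // mulr_ge0 ?subr_ge0 // expr2 ler_pM //; lra.
  by rewrite /S; ring.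
have nQ : n * Q ^+ 2 <= x ^+ 2 / 16 * (n - be) ^+ 2.
  have D0 : 0 < r ^+ 2 - be by lra.
  rewrite -(ler_pM2l (exprn_gt0 2 D0)).
  apply: le_trans (_ : (r * Q) ^+ 2 * (n - be) ^+ 2 <= _).
    rewrite -subr_ge0 (_ : _ - _ = Q ^+ 2 * ((n - r ^+ 2) * (r ^+ 2 * n - be ^+ 2))).
      rewrite mulr_ge0 ?sqr_ge0 // mulr_ge0 ?subr_ge0 // expr2 ler_pM //; lra.
    by ring.
  rewrite [leRHS]mulrA ler_wpM2r ?sqr_ge0//.
  apply: le_trans (_ : (x / 4) ^+ 2 * (x ^+ 2 / 16) <= _); last first.
    apply: ler_wpM2r; first by rewrite divr_ge0 ?(ltW x20).
    by apply: lerXn2r; rewrite ?nnegrE; lra.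
  have -> : (x / 4) ^+ 2 * (x ^+ 2 / 16) = (x ^+ 2 / 16) ^+ 2 by field.
  have -> : (r * Q) ^+ 2 = (x ^+ 2 / 16) ^+ 2 * (r ^+ 2 * s ^+ 2) by rewrite /Q; field.
  rewrite ler_piMr ?sqr_ge0 // mulr_ile1 ?sqr_ge0 // expr_le1 // ?ltW //.
  by rewrite /r; lra.
(* In the ellipse equation the two terms are at most [1 - x^2 / 8] and [x^2 / 16] of the right-hand
   side, so they cannot add up to it. *)
have := ler_wpM2r (sqr_ge0 (n - be)) nP.
have := ler_wpM2r (sqr_ge0 (n + be)) nQ.
have : 0 < x ^+ 2 * ((n + be) ^+ 2 * (n - be) ^+ 2).
  by rewrite mulr_gt0 // mulr_gt0 // exprn_gt0 // addr_gt0.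
by nra.
Qed.

Lemma csegment_imaginary (R : realType) (a b : R) (z : R[i]) :
  0 < a -> a < b ->
  (csegment (0 +i* a) (0 +i* b) `|`
   csegment (- (0 +i* a)) (- (0 +i* b))) z ->
  exists2 s, z = 0 +i* s & a ^+ 2 <= s ^+ 2 <= b ^+ 2.
Proof.
move=> a0 ab.
have seg t : t \in `[0, 1] ->
    a ^+ 2 <= ((1 - t) * a + t * b) ^+ 2 <= b ^+ 2.
  rewrite in_itv /= => /andP[t0 t1].
  have sa : a <= (1 - t) * a + t * b by nra.
  have sb : (1 - t) * a + t * b <= b by nra.
  by apply/andP; split; apply: lerXn2r; rewrite ?nnegrE; lra.
case=> -[t t01 <-].
  by exists ((1 - t) * a + t * b); [simpc | exact: seg].
exists (- ((1 - t) * a + t * b)); last by rewrite sqrrN; exact: seg.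
by apply/eqP; rewrite eq_complex /=; apply/andP; split; apply/eqP; ring.
Qed.

(* Acts on rows (w_t - ws, w_(t-1) - ws), most recent iterate first. *)
Definition eg_momentum_companion (R : realType) (d : nat) (J : 'M[R]_d)
    (alpha beta eta : R) : 'M[R]_(d + d) :=
  block_mx ((1 + beta)%:M + (- alpha) *: J + (alpha * eta) *: (J *m J)) 1%:M
           (- beta%:M) 0.

(** At [l = i s] the coefficient of [z] is [-(P - i Q)], with [P] and [Q] as in
    [momentum_root_modulus] for the rescaled [s / b]. *)
Lemma eg_momentum_spectrum (R : realType) (d : nat) (J : 'M[R]_d) (a b : R) :
  0 < a -> a < b ->
  (forall l, eigenvalue (map_mx (real_complex R) J) l ->
     exists2 s, l = 0 +i* s & a ^+ 2 <= s ^+ 2 <= b ^+ 2) ->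
  let x := a / b in
  let A := eg_momentum_companion J (x ^+ 2 / (16 * b)) ((1 - x) ^+ 2)
             (16 / (x ^+ 2 * b)) in
  forall z, eigenvalue (map_mx (real_complex R) A) z ->
    `|z| < (1 - x / 2)%:C.
Proof.
move=> a0 ab Jab x A z.
have b0 : 0 < b by lra.
have x0 : 0 < x by rewrite divr_gt0.
have x1 : x < 1 by rewrite ltr_pdivrMr // mul1r.
set be := (1 - x) ^+ 2 in A *.
have be0 : be != 0 by rewrite expf_neq0 // gt_eqF // subr_gt0.
set al := x ^+ 2 / (16 * b) in A *; set et := 16 / _ in A *.
have aeE : al * et = (b ^+ 2)^-1 by rewrite /al /et; field; rewrite !gt_eqF.
have ae0 : al * et != 0 by rewrite aeE invr_eq0 expf_neq0 // gt_eqF.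
rewrite /A /eg_momentum_companion map_block_mx !map_mxD !map_mxZ map_mxM.
rewrite map_mxN !map_scalar_mx map_mx0 rmorph1.
case/companion_eigenvalue; rewrite ?fmorph_eq0 // => l Jl.
have [s -> /andP[sa sb]] := Jab l Jl.
case: z => u v /eqP; rewrite expr2; simpc => zP.
move: zP; rewrite eq_complex /= => /andP[/eqP Eu /eqP Ev].
have r0 : 0 < 1 - x / 2 by lra.
have alE : al * s = x ^+ 2 * (s / b) / 16 by rewrite /al; field; rewrite gt_eqF.
have sE : al * et * (s * s) = (s / b) ^+ 2.
  by rewrite aeE; field; rewrite gt_eqF.
rewrite sE alE in Eu Ev.
rewrite -[ltRHS]ger0_norm ?(ltW r0) // -sqrtr_sqr ltr_sqrt ?exprn_gt0 //.
apply: (@momentum_root_modulus _ x (s / b) u v).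
- by rewrite x0.
- rewrite !expr_div_n ler_pM2r ?invr_gt0 ?exprn_gt0 // sa.
  by rewrite ler_pdivrMr ?exprn_gt0 // mul1r.
- by rewrite -[RHS]Eu /be; ring.
- by rewrite -[RHS]Ev /be; ring.
Qed.

(** * Local rate and choice of parameters *)

Lemma eg_momentum_local_rate (R : realType) (d : nat)
    (F : 'rV[R]_d -> 'rV[R]_d) (ws : 'rV[R]_d) (alpha beta eta r rho : R) :
  0 < r -> r < rho -> rho < 1 ->
  differentiable F ws -> F ws = 0 ->
  (forall z, eigenvalue (map_mx (real_complex R)
     (eg_momentum_companion (jacobian F ws) alpha beta eta)) z ->
     `|z| < r%:C) ->
  converges_locally_linearly (eg_momentum F alpha beta eta) ws rho.
Proof.
move=> r0 rrho rho1 dF F0 spec; split.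
- by rewrite rho1 (lt_trans r0).
- by rewrite /eg_momentum F0 scaler0 subr0 F0 scaler0 subrr scaler0 subr0 addr0.
pose V := eg_momentum F alpha beta eta.
pose G (z : 'rV[R]_(d + d)) : 'rV[R]_(d + d) :=
  row_mx (V (ws + lsubmx z) (ws + rsubmx z) - ws) (lsubmx z).
have [|del [C [del0 CP]]] :=
    @perturbed_linear_iteration R _ _ r rho G r0 rrho rho1 spec.
  move=> e e0.
  have [del del0 delP] := @eg_momentum_first_order R d F ws alpha beta eta e dF F0 e0.
  exists del => // z zdel; rewrite /G -[X in X *m _]hsubmxK mul_row_block.
  rewrite mulmx1 mulmx0 addr0 opp_row_mx add_row_mx subrr.
  have zl := norm_lsubmx_le z.
  (* The second half of [G z] is exactly linear; only the first half leaves a remainder. *)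
  apply: norm_row_mx_le; last by rewrite normr0 mulr_ge0 // ltW.
  apply: le_trans (_ : e * `|lsubmx z| <= _); last by rewrite ler_wpM2l // ltW.
  have := delP (lsubmx z) (rsubmx z) (le_trans zl zdel).
  congr (`| _ - _ | <= _).
  rewrite !mulmxDr mulmxN !mul_mx_scalar -!scalemxAr mulmxA mulmxBl -scalemxAl.
  by apply/matrixP => i j; rewrite !mxE; ring.
exists [set y | `|y - ws| <= del], C; split.
  rewrite -nbhs_nbhs_norm; exists del => // y /=; rewrite /ball_ /= distrC.
  exact: ltW.
move=> w wV w0 w1 t.
(* [w t] sits in the right half of [z t], so the exponent needs no shift; [z 0] involves both
   initial points. *)
pose z t := row_mx (w t.+1 - ws) (w t - ws).
have zG k : z k.+1 = G (z k).
  by rewrite /G /z row_mxKl row_mxKr ![ws + _]addrC !subrK wV.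
apply: le_trans (CP z zG (norm_row_mx_le w1 w0) t).
by have := norm_rsubmx_le (z t); rewrite row_mxKr.
Qed.

Theorem proposition7 (R : realType) :
  exists M : R, let c : R := Num.sqrt 2 - 1 in
  forall (a b : R) (d : nat) (F : 'rV[R]_d -> 'rV[R]_d) (ws : 'rV[R]_d),
    0 < a -> a < b ->
    C1_field F ->
    F ws = 0 ->
    (forall z : R[i], jacobian_eigenvalue F ws z ->
       (csegment (0 +i* a) (0 +i* b) `|`
        csegment (- (0 +i* a)) (- (0 +i* b))) z) ->
    let rho := 1 - c * (a / b) + M * (a ^+ 2 / b ^+ 2) in
    rho < 1 ->
    exists alpha beta eta : R,
      [/\ 0 < alpha, 0 < beta, 0 < eta &
          converges_locally_linearly (eg_momentum F alpha beta eta) ws rho].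
Proof.
exists 0 => c a b d F ws a0 ab [dF _] F0 spec rho rho1.
have b0 : 0 < b by lra.
pose x := a / b.
have x0 : 0 < x by rewrite divr_gt0.
have x1 : x < 1 by rewrite ltr_pdivrMr // mul1r.
(* This makes [1 - x / 2] strictly smaller than [rho = 1 - c x], the gap that absorbs the nonlinear
   remainder. *)
have c2 : c < 1 / 2.
  rewrite /c ltrBlDr -[ltRHS]ger0_norm; last lra.
  by rewrite -sqrtr_sqr ltr_sqrt; lra.
exists (x ^+ 2 / (16 * b)), ((1 - x) ^+ 2), (16 / (x ^+ 2 * b)); split.
- by rewrite divr_gt0 ?exprn_gt0 // mulr_gt0.
- by rewrite exprn_gt0 // subr_gt0.
- by rewrite divr_gt0 // mulr_gt0 // exprn_gt0.
apply: (@eg_momentum_local_rate R d F ws _ _ _ (1 - x / 2)) => //.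
- by lra.
- rewrite /rho mul0r addr0 -/x; nra.
apply: eg_momentum_spectrum => // l Jl.
exact: csegment_imaginary (spec l Jl).
Qed.
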